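(* Let $A\in\mathbb{C}^{n\times n}$ with $\alpha(A)<0$, let $\gamma\in[0,1)$ and $\eta\ge 0$, and let $(x_\star,y_\star)$ be a global minimizer of $g$ over $\{(x,y): x>0,\ y\in\mathbb{R}\}$. If $\mathcal{K}(A)^{-1}\le\gamma$ and $\eta\in[0,\,2x_\star(\gamma-\mathcal{K}(A)^{-1})]$, then there exists a pair $x,y\in\mathbb{R}$ with $x>0$ such that $$g(x,y)=g(x,y+\eta)=\gamma.$$
   Context: $\alpha(A)$ is the spectral abscissa (largest real part of an eigenvalue), $\sigma_{\min}$ the smallest singular value, $\|\cdot\|$ the spectral norm, $\mathbf{i}$ the imaginary unit. The continuous-time Kreiss constant is $\mathcal{K}(A)=\sup_{z\in\mathbb{C},\,\mathrm{Re}\,z>0}(\mathrm{Re}\,z)\|(zI-A)^{-1}\|$. For $x\neq 0$ and $y\in\mathbb{R}$ define $$g(x,y)=\sigma_{\min}\!\left(\frac{(x+\mathbf{i}y)I-A}{x}\right),$$ so that $\mathcal{K}(A)^{-1}=\inf_{x>0,\,y\in\mathbb{R}}g(x,y)$. A global minimizer $(x_\star,y_\star)$ satisfies $x_\star>0$ and $g(x_\star,y_\star)=\mathcal{K}(A)^{-1}$. *)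

(* Defs.v *)
From HB Require Import structures.
From mathcomp Require Import all_boot all_order all_algebra.
From mathcomp Require Import complex.
From mathcomp Require Import classical_sets reals.

Set Implicit Arguments.
Unset Strict Implicit.
Unset Printing Implicit Defensive.

Import Order.TTheory GRing.Theory Num.Theory.

Local Open Scope classical_set_scope.
Local Open Scope ring_scope.
Local Open Scope complex_scope.
Local Open Scope sesquilinear_scope.

(* [complex.Re : R[i] -> R] is used throughout rather than ['Re : R[i] -> R[i]],
   so that all the quantities below take values in [R]. Likewise [sup] and [inf]
   are the real-valued ones, which are 0 on sets without a supremum (infimum). *)

(* The spectrum is finite, and nonempty for 0 < n, so this [sup] is a max. *)
Definition spectral_abscissa (R : realType) (n : nat) (A : 'M[R[i]]_n) : R :=
  sup [set complex.Re a | a in [set a : R[i] | eigenvalue A a]].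

Definition euclidean_norm (R : realType) (n : nat) (v : 'cV[R[i]]_n) : R :=
  Num.sqrt (\sum_(i < n) complex.Re `|v i 0| ^+ 2).

(* The operator norm induced by the Euclidean norm. *)
Definition spectral_norm (R : realType) (n : nat) (M : 'M[R[i]]_n) : R :=
  sup [set euclidean_norm (M *m v) |
         v in [set v : 'cV[R[i]]_n | euclidean_norm v <= 1]].

Definition singular_value (R : realType) (n : nat) (M : 'M[R[i]]_n) (s : R) :=
  0 <= s /\ eigenvalue (M^t* *m M) (s ^+ 2)%:C.

(* There are finitely many singular values, and at least one for 0 < n,
   so this [inf] is a min. *)
Definition sigma_min (R : realType) (n : nat) (M : 'M[R[i]]_n) : R :=
  inf [set s | singular_value M s].

(* Meant for [spectral_abscissa A < 0]: then z I - A is invertible whenever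
   0 < Re z and the set is bounded. Otherwise [invmx] and [sup] may return
   default values instead of +oo. *)
Definition kreiss_constant (R : realType) (n : nat) (A : 'M[R[i]]_n) : R :=
  sup [set complex.Re z * spectral_norm (invmx (z%:M - A)) |
         z in [set z : R[i] | 0 < complex.Re z]].

Definition kreiss_g (R : realType) (n : nat) (A : 'M[R[i]]_n) (x y : R) : R :=
  sigma_min ((x%:C)^-1 *: ((x +i* y)%:M - A)).

(* Main.v *)
Require Import Defs.
From mathcomp Require Import all_boot all_order all_algebra.
From mathcomp Require Import complex.
From mathcomp Require Import boolp classical_sets set_interval reals.
From mathcomp Require Import interval_inference prodnormedzmodule topology.
From mathcomp Require Import normedtype derive.
From mathcomp Require Import zify ring lra.

(** Write f(x,y) = sigma_min((x+iy)I - A), so that g = gamma means f = gamma x.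
    Since f is 1-Lipschitz, the set {f <= gamma x} contains the vertical segment
    of length eta centred at the minimizer; since gamma < 1 it is compact, and
    since A is stable it avoids the imaginary axis. Hence it suffices to prove a
    topological statement: if a compact set S of the plane contains a vertical
    segment of length eta, then its boundary meets its translate by eta.

    This is proved on a triangulated grid whose vertical mesh divides eta, and
    transferred by compactness. On the grid, replace S by the connected component
    of the segment with its holes filled, so that S and its complement are both
    connected. If no triangle were crossed by the boundary of S and by that of
    its translate S', the boundary edges of S' lying in S would form a mod 2
    cocycle, hence a coboundary because the grid is simply connected, so that
    the boundary of S' would lie entirely inside or entirely outside S. As its
    lowest point is outside S, it lies outside; but S is connected and joins a
    point of S' (the lower end of the segment) to its own top point, which is not
    in S'. *)

Set Implicit Arguments.
Unset Strict Implicit.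
Unset Printing Implicit Defensive.

Import Order.TTheory GRing.Theory Num.Theory.
Import numFieldNormedType.Exports.

(** * Boundaries of sets of grid points *)

Definition east (p : nat * nat) := (p.1.+1, p.2).
Definition north (k : nat) (p : nat * nat) := (p.1, p.2 + k).
Definition northeast (p : nat * nat) := (p.1.+1, p.2.+1).

Definition edge (p q : nat * nat) := [|| q == east p, q == north 1 p | q == northeast p].

(** Connectedness is tested on two-colourings that are constant along edges inside [S], so that no
    path has to be handled; [component] follows the same pattern. *)
Definition grid_connected (S : pred (nat * nat)) := forall c : pred (nat * nat),
  (forall p q, edge p q -> S p -> S q -> c p = c q) ->
  forall p q, S p -> S q -> c p = c q.

Definition component (S : pred (nat * nat)) (b : nat * nat) : pred (nat * nat) :=
  fun p => `[< forall c : pred (nat * nat),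
    (forall q r, edge q r -> S q -> S r -> c q = c r) -> c p = c b >].

(* The pair (p, q) stands for the triangle with vertices p, q, northeast p. *)
Definition triangle (p q : nat * nat) := (q == east p) || (q == north 1 p).

Definition mixed (S : pred (nat * nat)) (p q : nat * nat) :=
  ~~ ((S p == S q) && (S q == S (northeast p))).

Section Component.
Variables (S : pred (nat * nat)) (b : nat * nat).
Hypothesis Sb : S b.

Lemma component_refl : component S b b.
Proof. exact/asboolP. Qed.

Lemma component_sub p : component S b p -> S p.
Proof.
by move=> /asboolP/(_ S) -> // q r _ -> ->.
Qed.

Lemma component_edge p q : edge p q -> S p -> S q ->
  component S b p = component S b q.
Proof.
move=> epq Sp Sq; apply/asboolP/asboolP => H c Hc; rewrite -(H c Hc).
  by rewrite (Hc p q).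
by rewrite (Hc p q).
Qed.

Lemma component_connected : grid_connected (component S b).
Proof.
move=> c Hc p q Cp Cq.
suff H r : component S b r -> c r = c b by rewrite !H.
(* Extend [c] by a constant off the component. No edge inside [S] leaves the component, so this is
   an admissible test colouring for [r]. *)
move=> Cr; have /asboolP/(_ (fun p => if component S b p then c p else ~~ c b)) := Cr.
rewrite Cr component_refl; apply=> {p q r Cp Cq Cr} p q epq Sp Sq.
rewrite (component_edge epq Sp Sq); case: ifP => // Cq.
by apply: Hc => //; rewrite (component_edge epq Sp Sq).
Qed.

End Component.

Lemma grid_connectedT : grid_connected predT.
Proof.
move=> c Hc p q _ _.
suff H r : c r = c (0, 0) by rewrite !H.
case: r => i j; elim: j => [|j <-].
  by elim: i => [|i <-] //; apply/esym/Hc => //; rewrite /edge eqxx.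
by apply/esym/Hc => //; rewrite /edge /north addn1 eqxx orbT.
Qed.

(** The complement of [V] is [C] with its holes filled, [o] marking the exterior. Filling creates no
    boundary edge: if [S] agrees at both ends of an edge, then so does [C], and hence [V]. *)
Lemma fill_connected (S C : pred (nat * nat)) (o b : nat * nat) :
  (forall p, C p -> S p) -> C b -> ~~ C o ->
  (forall p q, edge p q -> S p -> S q -> C p = C q) ->
  grid_connected C ->
  let V := component (predC C) o in
  [/\ grid_connected (predC V), grid_connected V, forall p, C p -> ~~ V p &
      forall p q, edge p q -> V p != V q -> S p != S q].
Proof.
move=> CS Cb nCo CE Ccon V.
have VC p : C p -> ~~ V p by move=> Cp; apply/negP => /(component_sub nCo)/=; rewrite Cp.
have VE p q : edge p q -> ~~ C p -> ~~ C q -> V p = V q.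
  exact: (@component_edge (predC C)).
split=> //; last 1 first.
- move=> p q epq VN; apply/eqP => SE.
  have CE' : C p = C q.
    case Sp: (S p); first by apply: CE => //; rewrite -?SE.
    by rewrite !(contraFF (CS _)) // -SE.
  case Cp: (C p); last by move: VN; rewrite (VE p q) ?eqxx -?CE' ?Cp.
  by move: VN; rewrite !(negbTE (VC _ _)) // -CE'.
- move=> c Hc.
  suff H p : ~~ V p -> c p = c b by move=> p q Vp Vq; rewrite !H.
  move=> Vp; apply/eqP/negP => /negP cpb.
  (* [D] collects the wrongly coloured points of the filled set. It misses [C], which is connected
     and contains [b], and no edge joins a hole of [C] to [V]. So [D] is constant along all edges of
     the grid, and it is empty because [b] is not in it. *)
  pose D q := ~~ V q && (c q != c b).
  have DC q : C q -> D q = false.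
    move=> Cq; rewrite /D; rewrite (Ccon c _ q b) ?eqxx ?andbF //.
    by move=> r s ers Cr Cs; apply: Hc => //; exact: VC.
  have Dstep q r : edge q r -> D q = D r.
    move=> eqr; case Vq: (V q); case Vr: (V r); rewrite /D Vq Vr //=.
    - apply/esym/negbTE/negP => cr; have : D r by rewrite /D Vr.
      case Cr: (C r); first by rewrite DC.
      suff : V r by rewrite Vr.
      by rewrite -(VE q r) ?Cr //; exact: (component_sub nCo Vq).
    - apply/negbTE/negP => cr; have : D q by rewrite /D Vq.
      case Cr: (C q); first by rewrite DC.
      suff : V q by rewrite Vq.
      by rewrite (VE q r) ?Cr //; exact: (component_sub nCo Vr).
    - by rewrite (Hc q r) //= ?Vq ?Vr.
  have : D p = D b by apply: (@grid_connectedT D) => // q r e _ _; exact: Dstep.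
  by rewrite /D Vp cpb eqxx andbF.
- exact: component_connected.
Qed.

Lemma edgeP p q : edge p q -> [\/ q = east p, q = north 1 p | q = northeast p].
Proof. by case/or3P => /eqP->; [constructor 1|constructor 2|constructor 3]. Qed.

(* H^1(grid; Z/2) = 0: the triangulated quarter plane is simply connected. *)
Lemma grid_coboundary (e : nat * nat -> nat * nat -> bool) :
  (forall p q, triangle p q -> e p q (+) e q (northeast p) = e p (northeast p)) ->
  exists c : pred (nat * nat), forall p q, edge p q -> e p q = c p (+) c q.
Proof.
move=> tri.
(* The potential sums [e] along the bottom row and then up the column. Horizontal edges follow by
   induction on the row, through the two triangles of a cell, which share its diagonal. *)
pose fix cx i := if i is i'.+1 then cx i' (+) e (i', 0) (i, 0) else false.
pose fix cy i j := if j is j'.+1 then cy i j' (+) e (i, j') (i, j) else cx i.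
pose c p := cy p.1 p.2.
have cU i j : e (i, j) (i, j.+1) = c (i, j) (+) c (i, j.+1).
  by rewrite /c /= addKb.
have cR i j : e (i, j) (i.+1, j) = c (i, j) (+) c (i.+1, j).
  elim: j => [|j IH]; first by rewrite /c /= addKb.
  have := tri (i, j) (east (i, j)); rewrite /triangle eqxx => /(_ isT).
  have := tri (i, j) (north 1 (i, j)); rewrite /triangle eqxx orbT => /(_ isT) <-.
  rewrite /east /north /northeast /= addn1 IH !cU.
  by move: (e _ _) (c _) (c _) (c _) (c _) => [] [] [] [] [].
exists c => -[i j] q /edgeP[] ->; rewrite /east /north /northeast /= ?addn1 ?cR ?cU //.
have := tri (i, j) (east (i, j)); rewrite /triangle eqxx => /(_ isT) <-.
rewrite /east /= cR cU.
by move: (c _) (c _) (c _) => [] [] [].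
Qed.

(** The boundary edges of [S] that start in [F] form a cocycle: on a triangle crossed by the
    boundary of [S], [F] is constant. Its potential [c] is constant on [S] and on the complement of
    [S], so it jumps equally across all boundary edges. Later [S] is the translated set and [F] the
    original one. *)
Lemma boundary_monochromatic (S F : pred (nat * nat)) :
  grid_connected S -> grid_connected (predC S) ->
  (forall p q, triangle p q -> mixed S p q -> ~~ mixed F p q) ->
  forall p q r s, edge p q -> edge r s -> S p != S q -> S r != S s -> F p = F r.
Proof.
move=> Sc nSc nomix.
pose e p q := (S p != S q) && F p.
have [p q pq|c cE] := @grid_coboundary e.
  have := nomix p q pq; rewrite /e /mixed.
  by move: (S p) (S q) (S (northeast p)) (F p) (F q) (F (northeast p))
    => [] [] [] [] [] [] //= /(_ isT).
have cS p q : edge p q -> S p = S q -> c p = c q.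
  by move=> epq SE; apply/eqP; have := cE _ _ epq; rewrite /e SE eqxx /=; case: (c p); case: (c q).
have c1 p q : S p -> S q -> c p = c q.
  by apply: Sc => {}p {}q epq Sp Sq; apply: cS => //; rewrite Sp.
have c2 p q : ~~ S p -> ~~ S q -> c p = c q.
  apply: nSc => {}p {}q epq /negbTE Sp /negbTE Sq; by apply: cS => //; rewrite Sp.
move=> p q r s epq ers Spq Srs.
have := cE _ _ epq; have := cE _ _ ers; rewrite /e Spq Srs /= => -> ->.
have H x y x' y' : S x -> ~~ S y -> S x' -> ~~ S y' -> c x (+) c y = c x' (+) c y'.
  by move=> Sx Sy Sx' Sy'; rewrite (c1 x x') // (c2 y y').
case Sp: (S p) Spq => /=; case Sq: (S q) => // _; case Sr: (S r) Srs => /=; case Ss: (S s) => // _.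
- by apply: H => //; rewrite ?Sq ?Ss.
- by rewrite (addbC (c r)); apply: H => //; rewrite ?Sq ?Sr.
- by rewrite (addbC (c p)); apply: H => //; rewrite ?Sp ?Ss.
- by rewrite addbC (addbC (c r)); apply: H => //; rewrite ?Sp ?Sr.
Qed.

(** * Crossings of a boundary with its vertical translate *)

Lemma triangle_north k p q : triangle (north k p) (north k q) = triangle p q.
Proof.
case: p q => [i j] [i' j']; rewrite /triangle /north /east /northeast /= !xpair_eqE /=; lia.
Qed.

Definition south (k : nat) (p : nat * nat) := (p.1, p.2 - k).

Lemma north_south k p : k <= p.2 -> north k (south k p) = p.
Proof. by case: p => i j /= kj; rewrite /north /south /= subnK. Qed.

Lemma south_north k p : south k (north k p) = p.
Proof. by case: p => i j; rewrite /north /south /= addnK. Qed.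

(** Truncated subtraction flattens the rows below [k]: a vertical edge starting there collapses to a
    point and a diagonal one becomes horizontal. *)
Lemma edge_south k p q : edge p q -> south k p = south k q \/ edge (south k p) (south k q).
Proof.
case: p => i j /edgeP[] ->;
  rewrite /edge /east /north /northeast /south /= !xpair_eqE; last 2 first.
- by case: (leqP k j) => kj; [right|left; congr pair]; lia.
- by right; case: (leqP k j) => kj; lia.
- by right; rewrite !eqxx.
Qed.

Lemma grid_connected_north k (S : pred (nat * nat)) : (forall p, S p -> k < p.2) ->
  grid_connected S -> grid_connected (S \o north k).
Proof.
move=> Sk Sc c Hc p q Fp Fq; rewrite -(south_north k p) -(south_north k q).
apply: (Sc (c \o south k)) => // {p q Fp Fq} p q epq Sp Sq /=.
have [->//|] := edge_south k epq; move=> /Hc; apply=> /=; rewrite north_south // ltnW //; exact: Sk.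
Qed.

Lemma grid_connected_northC k (S : pred (nat * nat)) : (forall p, S p -> k < p.2) ->
  grid_connected (predC S) -> grid_connected (predC (S \o north k)).
Proof.
move=> Sk Sc c Hc p q Fp Fq; rewrite -(south_north k p) -(south_north k q).
(* Points below row [k] are pushed up to row [k], which misses [S] because the bound [k < p.2] is
   strict. *)
have H r : ~~ S r -> ~~ S (north k (south k r)).
  case: (leqP k r.2) => kr; first by rewrite north_south.
  by move=> _; apply/negP => /Sk; rewrite /=; lia.
apply: (Sc (c \o south k)) => // {p q Fp Fq} p q epq Sp Sq /=.
by have [->//|] := edge_south k epq; move=> /Hc; apply=> /=; exact: H.
Qed.

Lemma connected_translate_crossing (S : pred (nat * nat)) k N b : 0 < k ->
  (forall p, S p -> (k < p.2) && (p.2 <= N)) ->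
  grid_connected S -> grid_connected (predC S) -> S b -> S (north k b) ->
  exists p q, [/\ triangle p q, mixed S p q & mixed S (north k p) (north k q)].
Proof.
move=> k_gt0 Sbd Sc nSc Sb Skb; apply: contrapT => nomix.
have Sk p : S p -> k < p.2 by move=> /Sbd/andP[].
pose P j := `[< exists i, S (i, j) >].
have exP : exists j, P j by exists b.2; apply/asboolP; exists b.1; case: (b) Sb.
have ubP j : P j -> j <= N by move=> /asboolP[i /Sbd/andP[]].
have [t /asboolP[it St] tmax] := ex_maxnP exP ubP.
have [m /asboolP[im Sm] mmin] := ex_minnP exP.
have km : k < m by exact: Sk Sm.
have edge_north1 p : edge p (north 1 p) by rewrite /edge eqxx orbT.
have mono : forall p q, edge p q -> S (north k p) != S (north k q) -> S p = false.
  move=> p q epq /= Fpq.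
  (* Compare with the edge that enters the translate at its lowest row [m - k]. Its lower end is in
     row [m - k - 1], a true subtraction as [k < m], and is outside [S] because [m] is the lowest
     row of [S]. *)
  have -> : S p = S (im, m - k - 1).
    apply: (@boundary_monochromatic (S \o north k) S _ _ _ p q _ (north 1 (im, m - k - 1))) => //.
    - exact: grid_connected_north.
    - exact: grid_connected_northC.
    - by move=> r s rs m1; apply/negP => m2; apply: nomix; exists r, s.
    - rewrite /north /=.
      have -> : m - k - 1 + 1 + k = m by lia.
      rewrite Sm; apply/negP => /eqP S1.
      by have := mmin (m - k - 1 + k); rewrite /P asboolT; [lia | exists im].
  apply/negP => S1; have := mmin (m - k - 1); rewrite /P asboolT; [lia | by exists im].
(* By [mono] the translate is constant along the edges of [S], hence on all of [S]. It contains [b]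
   but not the top point [(it, t)], since row [t + k] is above [t]. *)
have : S (north k b) = S (north k (it, t)).
  apply: (Sc (S \o north k)) => // p q epq Sp _ /=.
  by apply/eqP; apply: contraTT Sp => /(mono _ _ epq) ->.
rewrite Skb => /esym S1; have := tmax (t + k); rewrite /P asboolT; [lia | by exists it].
Qed.

(** Apply the connected case to the filled component of the segment. The segment puts both [b] and
    [north k b] in the component, and the mixed triangles found are mixed for [S] because filling
    adds no boundary edge. *)
Lemma translate_crossing (S : pred (nat * nat)) k N b : 0 < k ->
  (forall p, S p -> [&& k < p.2, p.1 <= N & p.2 <= N]) ->
  (forall j, j <= k -> S (north j b)) ->
  exists p q, [/\ triangle p q, mixed S p q & mixed S (north k p) (north k q)].
Proof.
move=> k_gt0 Sbd Sseg.
have Sb : S b by have := Sseg 0 isT; rewrite /north addn0; case: (b).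
pose C := component S b.
have nSo i : ~~ S (i, 0) by apply/negP => /Sbd.
have nCo i : ~~ C (i, 0) by apply: contra (nSo i); exact: component_sub.
have CS p : C p -> S p by exact: component_sub.
have Cseg j : j <= k -> C (north j b).
  elim: j => [|j IH] jk; first by rewrite /north addn0 -surjective_pairing; exact: component_refl.
  have e : edge (north j b) (north j.+1 b) by rewrite /edge /north /= addn1 addnS eqxx orbT.
  by rewrite /C -(component_edge b e) ?Sseg //; [exact/IH/ltnW | exact: ltnW].
have [] := @fill_connected S C (0, 0) b CS (component_refl S b) (nCo 0) _
  (@component_connected S b).
  exact: component_edge.
set V := component _ _ => VCc Vc VC mix.
(* The exterior of the box avoids [C] and is reached from the origin along the bottom row, up the
   columns beyond [N], back along the rows above [N], and up through the rows at most [k]. *)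
have Vout p : ~~ [&& k < p.2, p.1 <= N & p.2 <= N] -> V p.
  have VE q r : edge q r -> ~~ C q -> ~~ C r -> V q = V r by exact: component_edge.
  have nC q : ~~ [&& k < q.2, q.1 <= N & q.2 <= N] -> ~~ C q.
    by apply: contra => /CS/Sbd.
  have Vbot i : V (i, 0).
    elim: i => [|i IH]; first exact: component_refl.
    by rewrite -(VE (i, 0)) // /edge eqxx.
  have Vcol i j : N < i -> V (i, j).
    move=> Ni; elim: j => [|j IH] //.
    rewrite -(VE (i, j)) //; first by rewrite /edge /north addn1 eqxx orbT.
    - by apply: nC => /=; lia.
    - by apply: nC => /=; lia.
  have Vrow i j : N < j -> V (i, j).
    move=> Nj.
    have [Ni|] := ltnP N i; first exact: Vcol.
    move=> iN; have [d dE] : exists d, i + d = N.+1 by exists (N.+1 - i); lia.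
    elim: d i {iN} dE => [|d IH] i dE; first by apply: Vcol; lia.
    rewrite (VE _ (i.+1, j)) ?IH //; first lia.
    - by rewrite /edge eqxx.
    - by apply: nC => /=; lia.
    - by apply: nC => /=; lia.
  have Vlow i j : j <= k -> V (i, j).
    elim: j => [|j IH] jk //.
    rewrite -(VE (i, j)) ?IH //; first lia.
    - by rewrite /edge /north addn1 eqxx orbT.
    - by apply: nC => /=; lia.
    - by apply: nC => /=; lia.
  case: p => i j /=; have [/Vlow//|kj] := leqP j k.
  have [iN|/Vcol//] := leqP i N; have [jN|/Vrow//] := leqP j N; by [].
have mixedS p q : triangle p q -> mixed (predC V) p q -> mixed S p q.
  move=> tpq; apply: contra => /andP[/eqP S1 /eqP S2] /=.
  have [e1 e2] : edge p q /\ edge q (northeast p).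
    by case/orP: tpq => /eqP ->; rewrite /edge /east /north /northeast /= ?addn1 !eqxx ?orbT.
  move: (mix _ _ e1) (mix _ _ e2); rewrite -S2 -S1 eqxx.
  by case: (V p) (V q) (V (northeast p)) => [] [] [] // H1 H2; (have := H1 isT) || have := H2 isT.
have VCb : ~~ V b by apply: VC; exact: component_refl.
have VCkb : ~~ V (north k b) by apply: VC; exact: Cseg.
have VCC : grid_connected (predC (predC V)).
  move=> c Hc p q /negPn Vp /negPn Vq; apply: Vc => // r s ers Vr Vs.
  by apply: Hc => //=; exact/negPn.
have Vbd p : ~~ V p -> (k < p.2) && (p.2 <= N).
  by apply: contraR => H; apply: Vout; lia.
have [p [q [tpq m1 m2]]] := connected_translate_crossing k_gt0 Vbd VCc VCC VCb VCkb.
by exists p, q; split=> //; apply: mixedS => //; rewrite triangle_north.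
Qed.

(** * Common zeros of a function and of its translate *)

Local Open Scope ring_scope.

Lemma mixedP (S : pred (nat * nat)) p q : triangle p q -> mixed S p q ->
  exists v w, [/\ S v, ~~ S w,
    (p.1 <= v.1 <= p.1.+1)%N && (p.2 <= v.2 <= p.2.+1)%N &
    (p.1 <= w.1 <= p.1.+1)%N && (p.2 <= w.2 <= p.2.+1)%N].
Proof.
have H r : r \in [:: p; q; northeast p] -> triangle p q ->
    (p.1 <= r.1 <= p.1.+1)%N && (p.2 <= r.2 <= p.2.+1)%N.
  rewrite !inE => /or3P[]/eqP-> /orP[]/eqP qE; rewrite ?qE /east /north /northeast /=; lia.
move=> tpq m; suff [v [w [vT wT Sv nSw]]] : exists v w,
  [/\ v \in [:: p; q; northeast p], w \in [:: p; q; northeast p], S v & ~~ S w].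
  by exists v, w; split=> //; exact: H.
move: m; rewrite /mixed.
case Sp: (S p); case Sq: (S q); case Sd: (S (northeast p)) => //= _.
- by exists p, (northeast p); rewrite !inE !eqxx !orbT Sp Sd.
- by exists p, q; rewrite !inE !eqxx !orbT Sp Sq.
- by exists p, q; rewrite !inE !eqxx !orbT Sp Sq.
- by exists q, p; rewrite !inE !eqxx !orbT Sp Sq.
- by exists q, p; rewrite !inE !eqxx !orbT Sp Sq.
- by exists (northeast p), p; rewrite !inE !eqxx !orbT Sp Sd.
Qed.

Section TranslateZero.
Variables (R : realType) (u : R -> R -> R) (L X Y eta x0 y0 : R).
Hypothesis u_lip : forall x y x' y' : R,
  `|u x y - u x' y'| <= L * (`|x - x'| + `|y - y'|).
Hypothesis u_bd : forall x y : R, 0 <= x -> u x y <= 0 -> x <= X /\ `|y| <= Y.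
Hypothesis u_seg : forall y, y0 <= y <= y0 + eta -> u x0 y <= 0.

(** The meshes [x0 / n] and [eta / n] put [x0] on column [n] and make the translation by [eta] a
    shift by [n] rows. The lower bound [yb] is chosen before [n], so that all approximate zeros lie
    in one compact box. *)
Lemma translate_approx_zero : 0 < eta -> 0 < x0 -> 0 <= L ->
  exists yb : R, forall n, (0 < n)%N ->
  exists x y : R, [/\ 0 <= x <= X, yb <= y <= Y,
    `|u x y| <= L * (x0 + eta) / n%:R & `|u x (y + eta)| <= L * (x0 + eta) / n%:R].
Proof.
move=> eta_gt0 x0_gt0 L_ge0.
have [_ Yy0] : x0 <= X /\ `|y0| <= Y.
  by apply: u_bd; [exact: ltW | apply: u_seg; rewrite lexx lerDl ltW].
have Y_ge0 : 0 <= Y by apply: le_trans Yy0.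
have y0Y : `|y0| + 2 * eta + Y >= 0 by rewrite !addr_ge0 // mulr_ge0 // ltW.
(* [yb] lies below [y0] by a multiple of [eta], so the segment starts on row [B * n]. Moreover
   [yb + eta < - Y], so the points with [u <= 0] lie strictly above row [n]. *)
pose B := Num.bound ((`|y0| + 2 * eta + Y) / eta).
have BE : `|y0| + 2 * eta + Y < B%:R * eta.
  by rewrite -ltr_pdivrMr // archi_boundP // divr_ge0 // ltW.
pose yb := y0 - B%:R * eta.
have ybY : yb + eta < - Y by have := ler_norm y0; rewrite /yb; lra.
exists yb => n n_gt0.
have n0 : 0 < n%:R :> R by rewrite ltr0n.
have nN0 : n%:R != 0 :> R by rewrite gt_eqF.
pose hx := x0 / n%:R; pose hy := eta / n%:R.
have hx_gt0 : 0 < hx by rewrite divr_gt0.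
have hy_gt0 : 0 < hy by rewrite divr_gt0.
pose gx (i : nat) := i%:R * hx; pose gy (j : nat) := yb + j%:R * hy.
pose S : pred (nat * nat) := fun p => u (gx p.1) (gy p.2) <= 0.
have gx_ge0 i : 0 <= gx i by rewrite mulr_ge0 // ltW.
have gyn j : gy (j + n)%N = gy j + eta.
  by rewrite /gy natrD mulrDl addrA /hy [n%:R * _]mulrC divfK.
have Sbd p : S p -> gx p.1 <= X /\ `|gy p.2| <= Y by move=> Sp; apply: u_bd.
pose N := maxn (Num.bound (X / hx)) (Num.bound ((Y - yb) / hy)).
have leN (x h : R) (i : nat) : 0 < h -> i%:R * h <= x -> (i <= Num.bound (x / h))%N.
  move=> h0 H; rewrite -(ler_nat R); apply: le_trans (ltW (archi_boundP _)).
    by rewrite ler_pdivlMr.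
  by apply: divr_ge0; [apply: le_trans H; rewrite mulr_ge0 // ltW | exact: ltW].
have SN p : S p -> [&& (n < p.2)%N, (p.1 <= N)%N & (p.2 <= N)%N].
  move=> /Sbd[Xp]; rewrite ler_norml => /andP[Yp1 Yp2]; apply/and3P; split.
  - rewrite ltnNge; apply/negP => pn.
    have : p.2%:R * hy <= n%:R * hy by rewrite ler_pM2r // ler_nat.
    by rewrite /hy [n%:R * _]mulrC divfK // -/hy; rewrite /gy in Yp1; lra.
  - by rewrite leq_max; apply/orP; left; exact: leN.
  - by rewrite leq_max; apply/orP; right; apply: leN => //; rewrite /gy in Yp2; lra.
have seg j : (j <= n)%N -> S (north j (n, B * n)%N).
  move=> jn; rewrite /S /north /=.
  have -> : gx n = x0 by rewrite /gx /hx mulrC divfK.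
  apply: u_seg; rewrite /gy natrD natrM mulrDl.
  have -> : B%:R * n%:R * hy = B%:R * eta by rewrite -mulrA /hy [n%:R * _]mulrC divfK.
  have : j%:R * hy <= n%:R * hy by rewrite ler_pM2r // ler_nat.
  have : 0 <= j%:R * hy by rewrite mulr_ge0 // ltW.
  by rewrite /hy [n%:R * _]mulrC divfK // -/hy /yb => h1 h2; apply/andP; split; lra.
have [p [q [tpq m1 m2]]] := translate_crossing n_gt0 SN seg.
have close (p' v : nat * nat) :
    (p'.1 <= v.1 <= p'.1.+1)%N && (p'.2 <= v.2 <= p'.2.+1)%N ->
    [/\ gx p'.1 <= gx v.1, gy p'.2 <= gy v.2 &
     `|u (gx p'.1) (gy p'.2) - u (gx v.1) (gy v.2)| <= L * (x0 + eta) / n%:R].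
  case/andP=> /andP[a1 a2] /andP[b1 b2].
  have X1 : gx p'.1 <= gx v.1 by rewrite ler_pM2r // ler_nat.
  have Y1 : gy p'.2 <= gy v.2 by rewrite lerD2l ler_pM2r // ler_nat.
  have X2 : gx v.1 <= gx p'.1 + hx.
    by rewrite /gx -[X in _ + X]mul1r -mulrDl natr1 ler_pM2r // ler_nat.
  have Y2 : gy v.2 <= gy p'.2 + hy.
    suff : v.2%:R * hy <= p'.2%:R * hy + hy by rewrite /gy; lra.
    by rewrite -[X in _ + X]mul1r -mulrDl natr1 ler_pM2r // ler_nat.
  split=> //; apply: le_trans (u_lip _ _ _ _) _.
  rewrite -mulrA ler_wpM2l // mulrDl -/hx -/hy.
  by rewrite lerD // distrC ger0_norm ?subr_ge0 //; lra.
(* A mixed triangle has a vertex with [u <= 0] and one with [0 < u], both within one cell of the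
   corner; the Lipschitz bound then makes [u] small at the corner. *)
have small p' q' : triangle p' q' -> mixed S p' q' ->
    [/\ gx p'.1 <= X, gy p'.2 <= Y & `|u (gx p'.1) (gy p'.2)| <= L * (x0 + eta) / n%:R].
  move=> t m; have [v [w [Sv nSw /close[vx vy uv] /close[_ _ uw]]]] := mixedP t m.
  have [Xv] := Sbd _ Sv; rewrite ler_norml => /andP[_ Yv].
  split; [lra|lra|].
  move: Sv nSw uv uw; rewrite /S -ltNge !ler_norml; lra.
have [x1 y1 u1] := small _ _ tpq m1.
have tpq' : triangle (north n p) (north n q) by rewrite triangle_north.
have [_ _] := small _ _ tpq' m2; rewrite /= gyn => u2.
exists (gx p.1), (gy p.2); split=> //; first by rewrite gx_ge0.
by rewrite y1 andbT /gy lerDl mulr_ge0 // ltW.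
Qed.

(** The continuous function [Phi] attains its minimum on the compact box, and the approximate zeros
    force this minimum to be 0. The case [x = 0] is excluded later. *)
Lemma translate_common_zero : 0 < eta -> 0 < x0 -> 0 <= L ->
  exists x y : R, [/\ 0 <= x, u x y = 0 & u x (y + eta) = 0].
Proof.
move=> eta_gt0 x0_gt0 L_ge0.
have [yb H] := translate_approx_zero eta_gt0 x0_gt0 L_ge0.
pose K := (`[0, X]%classic `*` `[yb, Y]%classic)%classic : set (R * R).
pose Phi (p : R * R) := `|u p.1 p.2| + `|u p.1 (p.2 + eta)|.
have K0 : (K !=set0)%classic.
  have [x [y [xX yY _ _]]] := H 1%N isT.
  by exists (x, y); split; rewrite /= in_itv.
have cK : compact K by apply: compact_setX; exact: segment_compact.
have Phi_lip p q : `|Phi p - Phi q| <= 4 * L * `|p - q|.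
  have h1 : `|p.1 - q.1| <= `|p - q| by rewrite [`|p - q|]prod_normE le_max lexx.
  have h2 : `|p.2 - q.2| <= `|p - q| by rewrite [`|p - q|]prod_normE le_max lexx orbT.
  have lip y y' : `|y - y'| <= `|p - q| ->
      `|(`|u p.1 y| - `|u q.1 y'|)| <= 2 * L * `|p - q|.
    move=> yy; apply: le_trans (ler_dist_dist _ _) _.
    apply: le_trans (u_lip _ _ _ _) _.
    by rewrite mulrAC [leRHS]mulrC ler_wpM2l //; lra.
  have := lip _ _ h2; have : `|(p.2 + eta) - (q.2 + eta)| <= `|p - q|.
    by rewrite [X in `|X|](_ : _ = p.2 - q.2) //; ring.
  move=> /lip; rewrite /Phi => l1 l2.
  rewrite [X in `|X|](_ : _ = (`|u p.1 p.2| - `|u q.1 q.2|) +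
    (`|u p.1 (p.2 + eta)| - `|u q.1 (q.2 + eta)|)); last by ring.
  by apply: le_trans (ler_normD _ _) _; lra.
have cPhi : continuous Phi.
  move=> p; apply/cvgrPdist_lt => e e0.
  near=> q.
  apply: le_lt_trans (Phi_lip _ _) _.
  (* The added 1 keeps the denominator positive when [L = 0]. *)
  have : `|p - q| < e / (4 * L + 1).
    by near: q; apply: cvgr_dist_lt => //; rewrite divr_gt0 //; lra.
  rewrite ltr_pdivlMr; last lra.
  by apply: le_lt_trans; rewrite mulrC ler_wpM2l //; lra.
have [[x y] cK' min] := compact_EVT_min K0 cK (continuous_subspaceT cPhi).
have [/= xX _] : K (x, y) by move: cK'; rewrite inE.
have xy n : (0 < n)%N -> Phi (x, y) <= 2 * (L * (x0 + eta)) / n%:R.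
  move=> n0; have [x' [y' [xX' yY' u1 u2]]] := H n n0.
  apply: le_trans (min (x', y') _) _; last by rewrite /Phi /= -mulrA; lra.
  by rewrite inE; split; rewrite /= in_itv.
have Phi0 : Phi (x, y) <= 0.
  rewrite leNgt; apply/negP => P0.
  pose n := Num.bound (2 * (L * (x0 + eta)) / Phi (x, y)).
  have A0 : 0 <= 2 * (L * (x0 + eta)) / Phi (x, y).
    by rewrite divr_ge0 ?mulr_ge0 ?addr_ge0 // ltW.
  have nP := archi_boundP A0; rewrite -/n in nP.
  have n0 : (0 < n)%N by rewrite -(ltr0n R); apply: le_lt_trans nP.
  by have := xy n n0; rewrite leNgt ltr_pdivrMr ?ltr0n // [Phi _ * _]mulrC -ltr_pdivrMr // nP.
have : 0 <= x by move: xX; rewrite in_itv /= => /andP[].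
have := normr_ge0 (u x y); have := normr_ge0 (u x (y + eta)).
move: Phi0; rewrite /Phi /= => P0 n1 n2 x_ge0; exists x, y; split=> //.
- by apply/eqP; rewrite -normr_eq0; apply/eqP; lra.
- by apply/eqP; rewrite -normr_eq0; apply/eqP; lra.
Unshelve. all: by end_near. Qed.

End TranslateZero.

(** * The smallest singular value *)

Section EuclideanNorm.
Local Open Scope complex_scope.
Local Open Scope sesquilinear_scope.
Variables (R : realType) (n : nat).
Implicit Types (v w : 'cV[R[i]]_n).

Lemma Re_normK (z : R[i]) : (complex.Re `|z|)%:C = `|z|.
Proof. by rewrite RRe_real // normr_real. Qed.

Lemma Re_normK_sqr (z : R[i]) : ((complex.Re `|z|) ^+ 2)%:C = `|z| ^+ 2.
Proof. by rewrite rmorphXn /= -[X in X ^+ 2]/(`|z|). Qed.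

Lemma Re_norm_ge0 (z : R[i]) : 0 <= complex.Re `|z|.
Proof. by rewrite -ler0c Re_normK. Qed.

Lemma euclidean_norm_ge0 v : 0 <= euclidean_norm v.
Proof. exact: sqrtr_ge0. Qed.

Lemma euclidean_norm_sqr v :
  ((euclidean_norm v) ^+ 2)%:C = \sum_(i < n) `|v i 0| ^+ 2.
Proof.
rewrite sqr_sqrtr; last by apply: sumr_ge0 => i _; rewrite sqr_ge0.
by rewrite rmorph_sum; apply: eq_bigr => i _; exact: Re_normK_sqr.
Qed.

Lemma euclidean_norm_dot v : ((euclidean_norm v) ^+ 2)%:C = (v^t* *m v) 0 0.
Proof.
rewrite euclidean_norm_sqr mxE; apply: eq_bigr => i _.
by rewrite !mxE -normCKC.
Qed.

(** Transfers the norm to the hermitian form on row vectors, which supplies the triangle inequality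
    and definiteness. *)
Lemma euclidean_normE v : (euclidean_norm v)%:C = sqrtC (dotmx v^T v^T).
Proof.
have -> : dotmx v^T v^T = ((euclidean_norm v) ^+ 2)%:C.
  rewrite euclidean_norm_sqr dotmxE mxE.
  by apply: eq_bigr => i _; rewrite !mxE -normCK.
by rewrite rmorphXn /= sqrCK // ler0c euclidean_norm_ge0.
Qed.

Lemma euclidean_normD v w :
  euclidean_norm (v + w) <= euclidean_norm v + euclidean_norm w.
Proof.
by rewrite -lecR rmorphD /= !euclidean_normE linearD /=; apply: triangle_lerif.
Qed.

Lemma euclidean_normZ (a : R[i]) v :
  euclidean_norm (a *: v) = complex.Re `|a| * euclidean_norm v.
Proof.
apply/eqP; rewrite -(eqrXn2 (_ : 0 < 2)%N) ?mulr_ge0 ?euclidean_norm_ge0 ?Re_norm_ge0 //.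
apply/eqP/complexI; rewrite euclidean_norm_sqr exprMn rmorphM /=.
rewrite euclidean_norm_sqr (Re_normK_sqr a).
by rewrite mulr_sumr; apply: eq_bigr => i _; rewrite mxE normrM exprMn.
Qed.

Lemma euclidean_norm_eq0 v : (euclidean_norm v == 0) = (v == 0).
Proof.
rewrite -(inj_eq (@complexI R)) euclidean_normE sqrtC_eq0 dnorm_eq0.
by rewrite -(inj_eq (@trmx_inj _ _ _)) linear0.
Qed.

Lemma euclidean_norm0 : euclidean_norm (0 : 'cV[R[i]]_n) = 0.
Proof. by apply/eqP; rewrite euclidean_norm_eq0. Qed.

End EuclideanNorm.

Section SigmaMin.
Local Open Scope complex_scope.
Local Open Scope sesquilinear_scope.
Variables (R : realType) (n : nat).
Hypothesis n_gt0 : (0 < n)%N.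
Implicit Types (M : 'M[R[i]]_n) (v w : 'cV[R[i]]_n).

Lemma unitary_euclidean_norm (P : 'M[R[i]]_n) v : P \is unitarymx ->
  euclidean_norm (P *m v) = euclidean_norm v.
Proof.
move=> Pu; apply/eqP; rewrite -(eqrXn2 (_ : 0 < 2)%N) ?euclidean_norm_ge0 //.
apply/eqP/complexI; rewrite !euclidean_norm_dot trmx_mul map_mxM mulmxA.
by rewrite -[_ *m P]mulmxA -invmx_unitary // mulVmx ?mulmx1 // unitarymx_unit.
Qed.

Lemma gram_norm M v :
  ((euclidean_norm (M *m v)) ^+ 2)%:C = (v^t* *m (M^t* *m M) *m v) 0 0.
Proof. by rewrite euclidean_norm_dot trmx_mul map_mxM !mulmxA. Qed.

Lemma gram_normal M : M^t* *m M \is normalmx.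
Proof.
apply/hermitian_normalmx/is_hermitianmxP.
by rewrite expr0 scale1r trmx_mul map_mxM trmxCK.
Qed.

Lemma gram_spectral M :
  exists (P : 'M[R[i]]_n) (s : 'I_n -> R), [/\ P \is unitarymx,
    forall i, 0 <= s i,
    forall i, row i P *m (M^t* *m M) = ((s i) ^+ 2)%:C *: row i P &
    forall v, (euclidean_norm (M *m v)) ^+ 2 =
      \sum_i (s i) ^+ 2 * (complex.Re `|(P *m v) i 0|) ^+ 2].
Proof.
have /orthomx_spectralP := gram_normal M.
set P := spectralmx _; set d := spectral_diag _ => HE.
have Pu : P \is unitarymx by exact: spectral_unitarymx.
have Punit := unitarymx_unit Pu.
have normE v : ((euclidean_norm (M *m v)) ^+ 2)%:C = \sum_i d 0 i * `|(P *m v) i 0| ^+ 2.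
  rewrite gram_norm HE invmx_unitary // !mulmxA.
  have -> : v ^t* *m P ^t* = (P *m v)^t* by rewrite trmx_mul map_mxM.
  rewrite -mulmxA mxE; apply: eq_bigr => i _.
  by rewrite mul_mx_diag !mxE mulrAC -normCKC mulrC.
(* The norm of [M] on the i-th unit eigenvector: nonnegative by construction, and its square is the
   i-th eigenvalue of the Gram matrix. *)
pose s i := euclidean_norm (M *m (invmx P *m delta_mx i 0)).
have dE i : d 0 i = ((s i) ^+ 2)%:C.
  rewrite normE (bigD1 i) //= mulKVmx // mxE !eqxx normr1 expr1n mulr1.
  by rewrite big1 ?addr0 // => j ji; rewrite mxE (negbTE ji) normr0 expr0n mulr0.
exists P, s; split=> //.
- by move=> i; exact: euclidean_norm_ge0.
- move=> i; rewrite -row_mul HE !mulmxA mulmxV // mul1mx.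
  by apply/rowP => j; rewrite mxE mul_diag_mx !mxE dE.
- move=> v; apply: complexI; rewrite normE rmorph_sum; apply: eq_bigr => i _.
  by rewrite dE -Re_normK_sqr -(rmorphM (real_complex R)).
Qed.

Lemma singular_value_norm M s : singular_value M s ->
  exists2 v, v != 0 & euclidean_norm (M *m v) = s * euclidean_norm v.
Proof.
case=> s_ge0 /eigenvalueP[u uH u0].
(* [eigenvalue] speaks of row vectors, so the column vector sought is the conjugate transpose. *)
exists (u^t*).
  by rewrite map_mx_eq0 -(inj_eq (@trmx_inj _ _ _)) trmxK trmx0.
apply/eqP; rewrite -(eqrXn2 (_ : 0 < 2)%N) ?mulr_ge0 ?euclidean_norm_ge0 //.
apply/eqP/complexI; rewrite gram_norm trmxCK uH exprMn [RHS]rmorphM /= euclidean_norm_dot.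
by rewrite trmxCK -scalemxAl mxE.
Qed.

(** In the eigenbasis the squared norm of [M *m v] is a sum of squares weighted by the [s i ^+ 2],
    so the least [s i] is a lower bound for the stretching. It is therefore the least singular
    value, and the infimum is a true minimum. *)
Lemma sigma_min_exists M : exists s, [/\ sigma_min M = s, singular_value M s &
  forall v, s * euclidean_norm v <= euclidean_norm (M *m v)].
Proof.
have [P [s [Pu s_ge0 sH sN]]] := gram_spectral M.
pose i0 := [arg min_(i < Ordinal n_gt0) s i]%O.
have s0P i : s i0 <= s i by rewrite /i0; case: arg_minP => // j _; apply.
have lo v : s i0 * euclidean_norm v <= euclidean_norm (M *m v).
  rewrite -(ler_pXn2r (_ : 0 < 2)%N) ?nnegrE ?mulr_ge0 ?euclidean_norm_ge0 //.
  rewrite exprMn sN -(unitary_euclidean_norm v Pu) sqr_sqrtr; last first.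
    by apply: sumr_ge0 => i _; rewrite sqr_ge0.
  rewrite mulr_sumr; apply: ler_sum => i _; rewrite ler_wpM2r ?sqr_ge0 //.
  by rewrite ler_pXn2r ?nnegrE.
have sv : singular_value M (s i0).
  split=> //; apply/eigenvalueP; exists (row i0 P) => //.
  apply/eqP => r0; have /row_unitarymxP/(_ i0 i0) := Pu.
  by rewrite r0 eqxx linear0l => /eqP; rewrite eq_sym oner_eq0.
have lb t : singular_value M t -> s i0 <= t.
  move=> /singular_value_norm[v v0 vE]; have := lo v; rewrite vE ler_pM2r //.
  by rewrite lt_neqAle eq_sym euclidean_norm_eq0 v0 euclidean_norm_ge0.
exists (s i0); split=> //; apply/eqP; rewrite eq_le /sigma_min; apply/andP; split.
  by apply: ge_inf => //; exists (s i0) => t /lb.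
by apply: lb_le_inf; [exists (s i0) | move=> t /lb].
Qed.

Lemma sigma_min_le M v : sigma_min M * euclidean_norm v <= euclidean_norm (M *m v).
Proof. by have [s [-> _]] := sigma_min_exists M. Qed.

Lemma sigma_min_attained M :
  exists2 v, euclidean_norm v = 1 & euclidean_norm (M *m v) = sigma_min M.
Proof.
have [s [-> /singular_value_norm[v v0 vE] _]] := sigma_min_exists M.
have N0 : euclidean_norm v != 0 by rewrite euclidean_norm_eq0.
exists ((euclidean_norm v)^-1%:C *: v).
  by rewrite euclidean_normZ ger0_norm ?ler0c ?invr_ge0 ?euclidean_norm_ge0 //= mulVf.
rewrite -scalemxAr euclidean_normZ ger0_norm ?ler0c ?invr_ge0 ?euclidean_norm_ge0 //=.
by rewrite vE mulrCA mulVf // mulr1.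
Qed.

Lemma sigma_min_ge0 M : 0 <= sigma_min M.
Proof. by have [v _ <-] := sigma_min_attained M; exact: euclidean_norm_ge0. Qed.

End SigmaMin.

(** * The Kreiss constant *)

Section ComplexNorm.
Local Open Scope complex_scope.
Variable R : realType.
Implicit Types a b : R.

Lemma Re_norm_rect a b : complex.Re `|a +i* b| = Num.sqrt (a ^+ 2 + b ^+ 2).
Proof. by []. Qed.

Lemma ler_Re_norm_rect a b : `|a| <= complex.Re `|a +i* b|.
Proof. by rewrite Re_norm_rect -sqrtr_sqr ler_wsqrtr // lerDl sqr_ge0. Qed.

Lemma ler_Im_norm_rect a b : `|b| <= complex.Re `|a +i* b|.
Proof. by rewrite Re_norm_rect -sqrtr_sqr ler_wsqrtr // lerDr sqr_ge0. Qed.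

Lemma Re_norm_rect_le a b : complex.Re `|a +i* b| <= `|a| + `|b|.
Proof.
rewrite Re_norm_rect -[leRHS]ger0_norm ?addr_ge0 // -sqrtr_sqr ler_wsqrtr //.
by rewrite sqrrD !real_normK ?num_real // lerD2r lerDl mulrn_wge0.
Qed.

Lemma Re_norm_real a : 0 <= a -> complex.Re `|a%:C| = a.
Proof. by move=> a0; rewrite ger0_norm // ler0c. Qed.

End ComplexNorm.

Section Kreiss.
Local Open Scope complex_scope.
Variables (R : realType) (n : nat).
Hypothesis n_gt0 : (0 < n)%N.
Implicit Types (M A : 'M[R[i]]_n) (v w : 'cV[R[i]]_n) (a z : R[i]).

Lemma euclidean_norm_bounded M :
  exists2 c, 0 <= c & forall v, euclidean_norm (M *m v) <= c * euclidean_norm v.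
Proof.
have [P [s [Pu s_ge0 _ sN]]] := gram_spectral M.
have c_ge0 : 0 <= \sum_i s i by apply: sumr_ge0.
exists (\sum_i s i) => // v.
rewrite -(ler_pXn2r (_ : 0 < 2)%N) ?nnegrE ?mulr_ge0 ?euclidean_norm_ge0 //.
rewrite exprMn sN -(unitary_euclidean_norm v Pu) sqr_sqrtr; last first.
  by apply: sumr_ge0 => i _; rewrite sqr_ge0.
rewrite mulr_sumr; apply: ler_sum => i _; rewrite ler_wpM2r ?sqr_ge0 //.
rewrite ler_pXn2r ?nnegrE // (bigD1 i) //= lerDl.
by apply: sumr_ge0.
Qed.

(** Test the shifted matrix on a unit vector that attains [sigma_min M]. *)
Lemma sigma_min_shift M a : sigma_min (M + a%:M) <= sigma_min M + complex.Re `|a|.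
Proof.
have [v v1 <-] := sigma_min_attained n_gt0 M.
have := sigma_min_le n_gt0 (M + a%:M) v; rewrite v1 mulr1 => /le_trans; apply.
rewrite mulmxDl mul_scalar_mx; apply: le_trans (euclidean_normD _ _) _.
by rewrite euclidean_normZ v1 mulr1.
Qed.

Lemma sigma_minZ M a : sigma_min (a *: M) = complex.Re `|a| * sigma_min M.
Proof.
apply/eqP; rewrite eq_le; apply/andP; split.
  have [v v1 <-] := sigma_min_attained n_gt0 M.
  have := sigma_min_le n_gt0 (a *: M) v.
  by rewrite v1 mulr1 -scalemxAl euclidean_normZ.
have [v v1 <-] := sigma_min_attained n_gt0 (a *: M).
rewrite -scalemxAl euclidean_normZ ler_wpM2l ?Re_norm_ge0 //.
by have := sigma_min_le n_gt0 M v; rewrite v1 mulr1.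
Qed.

Lemma sigma_min_unit M : M \in unitmx -> 0 < sigma_min M.
Proof.
move=> Mu; rewrite lt_neqAle sigma_min_ge0 // andbT eq_sym.
have [v v1 <-] := sigma_min_attained n_gt0 M.
rewrite euclidean_norm_eq0; apply/eqP => Mv.
have := v1; rewrite -[v](mulKmx Mu) Mv mulmx0 euclidean_norm0 => /eqP.
by rewrite eq_sym oner_eq0.
Qed.

(** The upper bound is [sigma_min_le] at [invmx M *m v]; it will bound the Kreiss constant from
    above, while positivity will allow its inversion. *)
Lemma spectral_norm_inv M : M \in unitmx ->
  0 < spectral_norm (invmx M) <= (sigma_min M)^-1.
Proof.
move=> Mu; have s0 := sigma_min_unit Mu.
have ub v : euclidean_norm v <= 1 -> euclidean_norm (invmx M *m v) <= (sigma_min M)^-1.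
  move=> v1; rewrite -[leRHS]mul1r ler_pdivlMr // mulrC.
  by apply: le_trans (sigma_min_le n_gt0 _ _) _; rewrite mulKVmx.
apply/andP; split; last first.
  apply: ge_sup => [|_ [v /= v1 <-]]; last exact: ub.
  by exists (euclidean_norm (invmx M *m 0)); exists 0 => //=; rewrite euclidean_norm0.
have [v v1 _] := sigma_min_attained n_gt0 M.
apply: (@lt_le_trans _ _ (euclidean_norm (invmx M *m v))).
  rewrite lt_neqAle euclidean_norm_ge0 andbT eq_sym euclidean_norm_eq0.
  apply/eqP => Mv; have := v1; rewrite -[v](mulKVmx Mu) Mv mulmx0 euclidean_norm0 => /eqP.
  by rewrite eq_sym oner_eq0.
apply: ub_le_sup; last by exists v => //=; rewrite v1.
by exists (sigma_min M)^-1 => _ [w /= w1 <-]; exact: ub.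
Qed.

Section Stable.
Variable A : 'M[R[i]]_n.
Hypothesis A_stable : spectral_abscissa A < 0.

Lemma eigenvalue_Re_lt0 a : eigenvalue A a -> complex.Re a < 0.
Proof.
move=> Aa; apply: le_lt_trans A_stable; apply: ub_le_sup; last by exists a.
(* The supremum bounds the eigenvalues only if their real parts are bounded above. The transpose
   appears because eigenvectors are rows. *)
have [c c0 cP] := euclidean_norm_bounded A^T.
exists c => _ [b /eigenvalueP[u uA u0] <-].
have := cP u^T; rewrite -trmx_mul uA linearZ /= euclidean_normZ ler_pM2r; last first.
  rewrite lt_neqAle euclidean_norm_ge0 andbT eq_sym euclidean_norm_eq0.
  by rewrite -(inj_eq (@trmx_inj _ _ _)) trmxK trmx0.
apply: le_trans; case: b {uA} => x y; apply: le_trans (ler_norm _) _.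
exact: ler_Re_norm_rect.
Qed.

(** The imaginary axis is included: there [sigma_min] is positive, which keeps the level sets of
    [kreiss_g] away from [x = 0]. *)
Lemma resolvent_unit z : 0 <= complex.Re z -> z%:M - A \in unitmx.
Proof.
move=> z0; rewrite unitmxE unitfE; apply/det0P => -[u u0 uz].
have /eigenvalue_Re_lt0 : eigenvalue A z.
  apply/eigenvalueP; exists u => //; apply/eqP.
  by rewrite -subr_eq0 -opprB oppr_eq0 -mul_mx_scalar -mulmxBr uz.
by rewrite ltNge z0.
Qed.

Lemma kreiss_gE x y : 0 < x -> kreiss_g A x y = sigma_min ((x +i* y)%:M - A) / x.
Proof.
move=> x0; rewrite /kreiss_g sigma_minZ -(fmorphV (real_complex R)) Re_norm_real ?invr_ge0 ?ltW //.
by rewrite mulrC.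
Qed.

Lemma kreiss_g_gt0 x y : 0 < x -> 0 < kreiss_g A x y.
Proof.
by move=> x0; rewrite kreiss_gE // divr_gt0 // sigma_min_unit // resolvent_unit //= ltW.
Qed.

(** Each term of the supremum is at most the inverse of [kreiss_g] at the same point, hence at most
    its inverse at the minimizer. *)
Lemma minimizer_le_kreiss xs ys : 0 < xs ->
  (forall x y : R, 0 < x -> kreiss_g A xs ys <= kreiss_g A x y) ->
  kreiss_g A xs ys <= (kreiss_constant A)^-1.
Proof.
move=> xs0 mini; have g0 := kreiss_g_gt0 ys xs0.
have ub z : 0 < complex.Re z ->
    complex.Re z * spectral_norm (invmx (z%:M - A)) <= (kreiss_g A xs ys)^-1.
  case: z => x y /= x0.
  have Mu : (x +i* y)%:M - A \in unitmx by rewrite resolvent_unit //= ltW.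
  have /andP[_ le] := spectral_norm_inv Mu.
  apply: (@le_trans _ _ (kreiss_g A x y)^-1).
    by rewrite kreiss_gE // invf_div ler_wpM2l // ltW.
  move: g0 (kreiss_g_gt0 y x0) (mini x y x0).
  by move: (kreiss_g _ _ _) (kreiss_g _ _ _) => g g' ? ? ?; rewrite lef_pV2 ?posrE.
(* Taking inverses requires a positive constant; [ub] ensures that the supremum is not a default
   value. *)
have K0 : 0 < kreiss_constant A.
  have Mu : (xs +i* ys)%:M - A \in unitmx by rewrite resolvent_unit //= ltW.
  have /andP[sn0 _] := spectral_norm_inv Mu.
  apply: (@lt_le_trans _ _ (xs * spectral_norm (invmx ((xs +i* ys)%:M - A)))).
    by rewrite mulr_gt0.
  apply: ub_le_sup; last by exists (xs +i* ys).
  by exists (kreiss_g A xs ys)^-1 => _ [z /= z0 <-]; exact: ub.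
rewrite -[leLHS]invrK lef_pV2 ?posrE ?invr_gt0 //.
apply: ge_sup => [|_ [z /= z0 <-]]; last exact: ub.
by exists (xs * spectral_norm (invmx ((xs +i* ys)%:M - A))); exists (xs +i* ys).
Qed.

End Stable.

Lemma sigma_min_resolvent_lip A (x y x' y' : R) :
  `|sigma_min ((x +i* y)%:M - A) - sigma_min ((x' +i* y')%:M - A)|
    <= `|x - x'| + `|y - y'|.
Proof.
have lip (a b c d : R) : sigma_min ((a +i* b)%:M - A) <=
    sigma_min ((c +i* d)%:M - A) + (`|a - c| + `|b - d|).
  have -> : (a +i* b)%:M - A = (c +i* d)%:M - A + ((a - c) +i* (b - d))%:M.
    have -> : a +i* b = (c +i* d) + ((a - c) +i* (b - d)) by simpc; rewrite !subrKC.
    by rewrite raddfD /= addrAC.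
  apply: le_trans (sigma_min_shift _ _) _.
  by rewrite lerD2l Re_norm_rect_le.
have := lip x' y' x y; rewrite (distrC x') (distrC y').
have := lip x y x' y'; move: (`|x - x'| + `|y - y'|) => d.
move: (sigma_min _) (sigma_min _) => s s' ? ?.
by rewrite ler_distl; apply/andP; split; lra.
Qed.

(** Reverse triangle inequality, with [c] an operator bound for [A]. With [gamma < 1] it bounds the
    set where [sigma_min] is at most [gamma * x]. *)
Lemma sigma_min_resolvent_coercive A :
  exists2 c, 0 <= c & forall z, complex.Re `|z| - c <= sigma_min (z%:M - A).
Proof.
have [c c0 cP] := euclidean_norm_bounded A; exists c => // z.
have [v v1 <-] := sigma_min_attained n_gt0 (z%:M - A).
have := euclidean_normD ((z%:M - A) *m v) (A *m v).
rewrite -mulmxDl subrK mul_scalar_mx euclidean_normZ v1 mulr1.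
have := cP v; rewrite v1 mulr1; lra.
Qed.

End Kreiss.

(** * Level sets [f = gamma * x] and the conclusion *)

Lemma lip_continuous (R : realType) (f : R -> R) (L : R) : 0 < L ->
  (forall y y', `|f y - f y'| <= L * `|y - y'|) -> continuous f.
Proof.
move=> L0 lip x; apply/cvgrPdist_lt => e e0; near=> y.
apply: le_lt_trans (lip _ _) _; rewrite mulrC -ltr_pdivlMr //.
by near: y; apply: cvgr_dist_lt => //; rewrite divr_gt0.
Unshelve. all: by end_near. Qed.

Lemma cone_level_translate (R : realType) (f : R -> R -> R)
    (c gamma eta xs ys : R) :
  0 <= gamma < 1 -> 0 <= eta -> 0 < xs ->
  (forall x y x' y', `|f x y - f x' y'| <= `|x - x'| + `|y - y'|) ->
  (forall x y, `|x| - c <= f x y) -> (forall x y, `|y| - c <= f x y) ->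
  (forall y, 0 < f 0 y) ->
  f xs ys + eta / 2 <= gamma * xs ->
  exists x y, [/\ 0 < x, f x y = gamma * x & f x (y + eta) = gamma * x].
Proof.
move=> /andP[gamma_ge0 gamma_lt1] eta_ge0 xs_gt0 f_lip cX cY f0 fs.
pose u x y := f x y - gamma * x.
have u_lip x y x' y' : `|u x y - u x' y'| <= 2 * (`|x - x'| + `|y - y'|).
  have -> : u x y - u x' y' = (f x y - f x' y') - gamma * (x - x') by rewrite /u; ring.
  apply: le_trans (ler_normB _ _) _; rewrite normrM (ger0_norm gamma_ge0).
  have := f_lip x y x' y'.
  have : gamma * `|x - x'| <= `|x - x'| by rewrite ler_piMl // ltW.
  have := normr_ge0 (y - y'); lra.
have u0 x y : u x y = 0 -> f x y = gamma * x by move/eqP; rewrite subr_eq0 => /eqP.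
(* From [x - c <= f x y <= gamma * x] comes [x <= X], and then [|y| - c <= gamma * x] gives [Y]. *)
pose X := c / (1 - gamma); pose Y := c + gamma * X.
have u_bd x y : 0 <= x -> u x y <= 0 -> x <= X /\ `|y| <= Y.
  rewrite /u => x0 uxy; have := cX x y; have := cY x y; rewrite (ger0_norm x0) => h1 h2.
  have xX : x <= X by rewrite ler_pdivlMr ?subr_gt0 // mulrBr mulr1; lra.
  split=> //; rewrite /Y.
  have : gamma * x <= gamma * X by rewrite ler_wpM2l.
  lra.
have u_seg y : ys - eta / 2 <= y <= ys - eta / 2 + eta -> u xs y <= 0.
  move=> /andP[y1 y2]; rewrite /u.
  have := f_lip xs y xs ys; rewrite subrr normr0 add0r.
  have : `|y - ys| <= eta / 2 by rewrite ler_distl; apply/andP; split; lra.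
  move=> h1 /le_trans - /(_ _ h1); rewrite ler_norml.
  by move=> /andP[_]; lra.
(* For [eta = 0] the vertical mesh would degenerate. A single zero suffices, found by the
   intermediate value theorem on the vertical line through the minimizer, going up past height
   [Y]. *)
have [eta0|eta_gt0] : eta = 0 \/ 0 < eta.
  by move: eta_ge0; rewrite le_eqVlt => /predU1P[<-|]; [left|right].
  have us : u xs ys <= 0 by apply: u_seg; rewrite eta0; apply/andP; split; lra.
  have [_ Yys] := u_bd xs ys (ltW xs_gt0) us.
  have Y0 : 0 <= Y by apply: le_trans Yys.
  have uc : ({within `[ys, `|ys| + Y + 1], continuous (u xs)})%classic.
    apply/continuous_subspaceT/(@lip_continuous _ _ 2) => // y y'.
    by apply: le_trans (u_lip _ _ _ _) _; rewrite subrr normr0 add0r.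
  have ysle : ys <= `|ys| + Y + 1 by have := ler_norm ys; lra.
  have ue : 0 <= u xs (`|ys| + Y + 1).
    rewrite leNgt; apply/negP => /ltW /(u_bd _ _ (ltW xs_gt0))[_].
    have := normr_ge0 ys; have := ler_norm (`|ys| + Y + 1); lra.
  have [|y _ uy] := IVT ysle uc (v := 0).
    by rewrite ge_min us le_max ue orbT.
  by exists xs, y; rewrite eta0 addr0; split=> //; exact: u0.
have [x [y [x_ge0 u1 u2]]] :=
  translate_common_zero u_lip u_bd u_seg eta_gt0 xs_gt0 (ler0n _ 2).
exists x, y; split; [|exact: u0|exact: u0].
(* At [x = 0] the level equation would read [f 0 y = 0], against [f0]. *)
rewrite lt_neqAle x_ge0 andbT; apply/eqP => x0.
by have := f0 y; rewrite x0 (u0 _ _ u1) -x0 mulr0 ltxx.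
Qed.

Theorem theorem4p1 (R : realType) (n : nat) (n_gt0 : (0 < n)%N)
    (A : 'M[R[i]]_n) (A_stable : spectral_abscissa A < 0)
    (gamma eta : R) (gamma_ge0 : 0 <= gamma) (gamma_lt1 : gamma < 1)
    (eta_ge0 : 0 <= eta)
    (xs ys : R) (xs_gt0 : 0 < xs)
    (minimizer : forall x y : R, 0 < x -> kreiss_g A xs ys <= kreiss_g A x y)
    (gamma_ge : (kreiss_constant A)^-1 <= gamma)
    (eta_le : eta <= 2 * xs * (gamma - (kreiss_constant A)^-1)) :
  exists x y : R,
    0 < x /\ kreiss_g A x y = gamma /\ kreiss_g A x (y + eta) = gamma.
Proof.
have f_lip := sigma_min_resolvent_lip n_gt0 A.
have [c c0 cP] := sigma_min_resolvent_coercive n_gt0 A.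
have f0 (y : R) : 0 < sigma_min ((0 +i* y)%C%:M - A).
  by rewrite sigma_min_unit // (resolvent_unit A_stable).
(* Multiply the bound of the minimum by the inverse Kreiss constant by [xs]; the assumption on [eta]
   leaves room for half the segment on either side of [ys]. *)
have fs : sigma_min ((xs +i* ys)%C%:M - A) + eta / 2 <= gamma * xs.
  have := minimizer_le_kreiss n_gt0 A_stable xs_gt0 minimizer.
  rewrite kreiss_gE // ler_pdivrMr //.
  move: (sigma_min _) (kreiss_constant A)^-1 eta_le => s k eta_le' sk.
  have : 2 * xs * (gamma - k) = 2 * (gamma * xs - k * xs) by ring.
  lra.
have cX (x y : R) : `|x| - c <= sigma_min ((x +i* y)%C%:M - A).
  by apply: le_trans (cP _); rewrite lerD2r ler_Re_norm_rect.
have cY (x y : R) : `|y| - c <= sigma_min ((x +i* y)%C%:M - A).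
  by apply: le_trans (cP _); rewrite lerD2r ler_Im_norm_rect.
have gamma01 : 0 <= gamma < 1 by rewrite gamma_ge0.
have [x [y [x_gt0 f1 f2]]] :=
  cone_level_translate gamma01 eta_ge0 xs_gt0 f_lip cX cY f0 fs.
by exists x, y; rewrite !kreiss_gE // f1 f2 mulfK // gt_eqF.
Qed.
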